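(* Let $\mathcal{P}\in\mathcal{Q}_n$ be an irreducible, tridiagonal sign pattern with a $0$-diagonal. If $\mathcal{P}_6$ or $(\mathcal{P}_6)_-$ is a submatrix of $\mathcal{P}$, then $\mathcal{P}$ is not consistent, where $$\mathcal{P}_6=\begin{bmatrix}0&+&0&0&0&0\\+&0&-&0&0&0\\0&+&0&-&0&0\\0&0&+&0&-&0\\0&0&0&+&0&+\\0&0&0&0&+&0\end{bmatrix}.$$
   Context: A sign pattern is a matrix with entries in $\{+,-,0\}$; $\mathcal{Q}_n$ is the set of $n\times n$ sign patterns; $\mathcal{Q}(\mathcal{P})$ is the set of real matrices whose entries have the signs prescribed by $\mathcal{P}=[p_{ij}]$. $\mathcal{P}$ is tridiagonal if $p_{ij}=0$ whenever $|i-j|>1$; irreducible tridiagonal means $p_{i,i+1}\ne0$, $p_{i+1,i}\neq0$ for all $i$; $0$-diagonal means $p_{ii}=0$. $\mathcal{P}$ is consistent if there is $k$ such that every $A\in\mathcal{Q}(\mathcal{P})$ has exactly $k$ real eigenvalues (with algebraic multiplicity). For a combinatorially symmetric pattern with $0$-diagonal, its signed undirected graph has vertices $1,\dots,n$, an edge $\{i,j\}$ ($i\neq j$) iff $p_{ij}\ne 0$, with sign $p_{ij}p_{ji}$. For a tree sign pattern $\mathcal{P}$ with $0$-diagonal, $\mathcal{P}_-$ denotes a sign pattern with the same zero/nonzero pattern whose signed undirected graph is obtained from that of $\mathcal{P}$ by reversing the sign of every edge. Thus $(\mathcal{P}_6)_-$ is a $6\times6$ tridiagonal $0$-diagonal pattern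 whose path edges $\{1,2\},\dots,\{5,6\}$ have signs $-,+,+,+,-$. *)

(* Defs.v *)
From mathcomp Require Import all_boot all_order all_algebra.
From mathcomp Require Import reals.
From mathcomp Require Import polyrcf.

Set Implicit Arguments.
Unset Strict Implicit.
Unset Printing Implicit Defensive.

Import Order.TTheory GRing.Theory Num.Theory.
Local Open Scope ring_scope.

(* The signs +, -, 0 are encoded as the integers 1, -1, 0, so that products of
   signs are products in int and the sign of a real number x is sgz x. *)
Definition is_sign_pattern (m n : nat) (P : 'M[int]_(m, n)) : Prop :=
  forall i j, P i j \in [:: 1; -1; 0].

Definition in_qualitative_class (R : realType) (n : nat)
    (P : 'M[int]_n) (A : 'M[R]_n) : Prop :=
  forall i j, sgz (A i j) = P i j.

Definition is_tridiagonal (n : nat) (P : 'M[int]_n) : Prop :=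
  forall i j : 'I_n, (i.+1 < j)%N || (j.+1 < i)%N -> P i j = 0.

(* Irreducibility of a tridiagonal pattern. *)
Definition is_irreducible_tridiagonal (n : nat) (P : 'M[int]_n) : Prop :=
  is_tridiagonal P /\
  forall i j : 'I_n, j = i.+1 :> nat -> P i j != 0 /\ P j i != 0.

Definition has_zero_diagonal (n : nat) (P : 'M[int]_n) : Prop :=
  forall i, P i i = 0.

(* rootsR p lists the distinct roots in R of a nonzero polynomial p, and
   mup x p is the multiplicity of x as a root of p. *)
Definition nb_real_eigenvalues (R : realType) (n : nat) (A : 'M[R]_n) : nat :=
  (\sum_(x <- rootsR (char_poly A)) mup x (char_poly A))%N.

Definition is_consistent (R : realType) (n : nat) (P : 'M[int]_n) : Prop :=
  exists k : nat, forall A : 'M[R]_n,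
    in_qualitative_class P A -> nb_real_eigenvalues A = k.

Definition is_edge (n : nat) (P : 'M[int]_n) (i j : 'I_n) : bool :=
  (i != j) && (P i j != 0).

Definition edge_sign (n : nat) (P : 'M[int]_n) (i j : 'I_n) : int :=
  P i j * P j i.

(* M is a possible choice of P_-, which is determined by P only through its
   signed graph. *)
Definition is_edge_reversal (n : nat) (P M : 'M[int]_n) : Prop :=
  [/\ is_sign_pattern M,
      forall i j, (M i j == 0) = (P i j == 0)
    & forall i j, is_edge P i j -> edge_sign M i j = - edge_sign P i j].

(* Row and column indices are selected in increasing order, and independently
   of each other: the submatrix is not required to be principal. *)
Definition is_submatrix (p q m n : nat)
    (B : 'M[int]_(p, q)) (P : 'M[int]_(m, n)) : Prop :=
  exists (f : 'I_p -> 'I_m) (g : 'I_q -> 'I_n),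
    [/\ {homo f : i j / (i < j)%N}, {homo g : i j / (i < j)%N}
      & mxsub f g P = B].

Definition P6_rows : seq (seq int) :=
  [:: [:: 0;  1;  0;  0;  0;  0];
      [:: 1;  0; -1;  0;  0;  0];
      [:: 0;  1;  0; -1;  0;  0];
      [:: 0;  0;  1;  0; -1;  0];
      [:: 0;  0;  0;  1;  0;  1];
      [:: 0;  0;  0;  0;  1;  0]].

Definition P6 : 'M[int]_6 :=
  \matrix_(i < 6, j < 6) nth 0 (nth [::] P6_rows i) j.

(* Main.v *)
(* The characteristic polynomial of an n x n tridiagonal matrix with zero diagonal is
   x^(n mod 2) q(x^2), where q depends only on the products a_i of the pairs of opposite
   entries. A positive root of q gives two real eigenvalues, a negative root two nonreal ones.
   Adding vertices to the path in pairs, with a huge weight on the edge joining the two new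
   vertices, preserves the sign changes of q at positive points and adds one if that edge is
   positive; negating all weights, the same holds for negative roots. So some matrix of the
   class has at least 2c real eigenvalues and another at least 2d nonreal ones, and each added
   pair contributes 1 to c + d. On a block of signs + - - - + (or - + + + -) pairing contributes
   only 2 + 1, but making the three inner edges dominate turns the 1 into a 3, and this gain
   yields 2(c + d) > n, so the number of real eigenvalues is not constant. *)
Require Import Defs.
From mathcomp Require Import all_boot all_order all_algebra.
From mathcomp Require Import reals polyrcf.
From mathcomp Require Import ring lra zify.

Set Implicit Arguments.
Unset Strict Implicit.
Unset Printing Implicit Defensive.

Import Order.TTheory GRing.Theory Num.Theory.
Local Open Scope ring_scope.

(** * Determinants and roots *)

(** Laplace expansion along the last row leaves two minors; the last column of the second one has at
    most one nonzero entry, [F n n.+1]. *)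
Lemma det_tridiagonal_rec (R : comPzRingType) (F : nat -> nat -> R) (n : nat)
    (Ftri : forall i j, (i.+1 < j)%N || (j.+1 < i)%N -> F i j = 0) :
  \det (\matrix_(i < n.+2, j < n.+2) F i j) =
    F n.+1 n.+1 * \det (\matrix_(i < n.+1, j < n.+1) F i j)
    - F n n.+1 * F n.+1 n * \det (\matrix_(i < n, j < n) F i j).
Proof.
have bumpE h k : (k < h)%N -> bump h k = k by rewrite /bump ltnNge => /negbTE ->.
rewrite (expand_det_row _ ord_max) !big_ord_recr /= big1 ?add0r; last first.
  by move=> j _; rewrite mxE Ftri ?mul0r //= !ltnS ltn_ord orbT.
have liftM m (i : 'I_m) : lift (@ord_max m) i = i :> nat.
  by rewrite lift_max.
rewrite addrC !mxE /=; congr (_ * _ + _).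
  rewrite /cofactor -signr_odd oddD addbb expr0 mul1r; congr (\det _).
  by apply/matrixP => i j; rewrite !mxE !liftM.
rewrite /cofactor (expand_det_col _ ord_max) big_ord_recr /= big1 ?add0r; last first.
  move=> i _; rewrite !mxE /=.
  have hi := ltn_ord i.
  suff /Ftri -> : ((bump n.+1 i).+1 < bump n n)%N || ((bump n n).+1 < bump n.+1 i)%N.
    by rewrite mul0r.
  by rewrite (bumpE _ _ (ltnW hi : i < n.+1)%N) {1}/bump leqnn add1n !ltnS hi.
rewrite !mxE /cofactor /=.
rewrite (@bumpE n.+1) //.
have -> : bump n n = n.+1 by rewrite /bump leqnn.
have -> : \det (row' ord_max (col' ord_max
   (row' ord_max (col' (widen_ord (leqnSn n.+1) ord_max)
     (\matrix_(i < n.+2, j < n.+2) F i j))))) = \det (\matrix_(i < n, j < n) F i j).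
  apply: congr1; apply/matrixP => i j; rewrite !mxE /=.
  have hi := ltn_ord i; have hj := ltn_ord j.
  by rewrite !(@bumpE n) // bumpE // (ltn_trans hi).
rewrite -[X in _ * (X * _)]signr_odd -[X in _ * (_ * (_ * (X * _)))]signr_odd.
rewrite addSn /= oddD addbb expr1 expr0; ring.
Qed.

(** Induction on the size: removing one linear factor lowers the sum by at most one, because [s]
    lists each point once. *)
Lemma sum_mup_le (F : fieldType) (p : {poly F}) (s : seq F) :
  p != 0 -> uniq s -> (\sum_(x <- s) mup x p <= (size p).-1)%N.
Proof.
move=> + us; have [m] := ubnP (size p); elim: m p => // m IHm p + p0.
rewrite ltnS => sp.
have [/allP sN|] := boolP (all (fun x => ~~ root p x) s).
  by rewrite big1_seq // => x /andP[_ /sN]; apply: mupNroot.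
rewrite -has_predC => /hasP[x xs /=]; rewrite negbK => /factor_theorem[g Dp].
have g0 : g != 0 by apply: contraNneq p0 => g0; rewrite Dp g0 mul0r.
have X0 : 'X - x%:P != 0 by rewrite polyXsubC_eq0.
have Sp : size p = (size g).+1.
  by rewrite Dp size_Mmonic ?monicXsubC // size_XsubC addn2.
have Sg : (0 < size g)%N by rewrite size_poly_gt0.
have := IHm g; rewrite Sp /= in sp *; move=> /(_ sp g0) IH.
rewrite Dp (eq_bigr (fun y => mup y g + mup y ('X - x%:P)))%N; last first.
  by move=> y _; rewrite mupM.
rewrite big_split /= -[leqRHS](prednK Sg) -addn1 leq_add //.
rewrite (eq_bigr (fun y => (y == x) : nat)); last first.
  move=> y _; have := mup_XsubCX 1 y x; rewrite expr1 => ->.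
  by rewrite eq_sym; case: eqP.
by rewrite -big_mkcond sum1_count /= (count_uniq_mem _ us) leq_b1.
Qed.

Section CountRoots.
Variable R : rcfType.
Implicit Types (p q : {poly R}) (s : seq R).

Lemma size_roots_le_sum_mup p s : p != 0 -> uniq s -> all (root p) s ->
  (size s <= \sum_(x <- rootsR p) mup x p)%N.
Proof.
move=> p0 us /allP sp.
have ur : uniq (rootsR p) by rewrite /rootsR uniq_roots.
have sub : {subset s <= rootsR p}.
  by move=> x /sp; rewrite -(roots_on_rootsR p0) in_itv.
apply: leq_trans (uniq_leq_size us sub) _.
rewrite -sum1_size big_seq [X in (_ <= X)%N]big_seq leq_sum // => x xr.
have : root p x by move: xr; rewrite -(roots_on_rootsR p0) => /andP[].
by rewrite -dvdp_XsubCl XsubC_dvd.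
Qed.

Lemma sum_mup_rootless p q : p * q != 0 -> (forall x, ~~ root p x) ->
  (\sum_(x <- rootsR (p * q)) mup x (p * q) <= (size q).-1)%N.
Proof.
move=> pq0 Np; have q0 : q != 0 by apply: contraNneq pq0 => ->; rewrite mulr0.
rewrite (eq_bigr (fun x => mup x q)) => [|x _]; last by rewrite mupMr.
by rewrite sum_mup_le ?uniq_roots.
Qed.

End CountRoots.

(** * Sign changes of continuants *)

Section Eventually.
Variable R : realFieldType.
Implicit Types (P Q : R -> Prop) (f : R -> R).

(** Stands in for limits at infinity: finitely many demands on a large parameter are collected
    before one value is fixed. *)
Definition eventually P := exists M, forall x, M <= x -> P x.

Lemma eventually_ge M : eventually (fun x => M <= x).
Proof. by exists M. Qed.

Lemma eventually_and P Q :
  eventually P -> eventually Q -> eventually (fun x => P x /\ Q x).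
Proof.
move=> [M HM] [N HN]; exists (Num.max M N) => x.
by rewrite ge_max => /andP[/HM + /HN].
Qed.

Lemma eventually_mono P Q : (forall x, P x -> Q x) -> eventually P -> eventually Q.
Proof. by move=> PQ [M HM]; exists M => x /HM /PQ. Qed.

Lemma eventually_scale P z : 0 < z -> eventually P -> eventually (fun x => P (x * z)).
Proof.
move=> z0 [M HM]; exists (M / z) => x xM; apply: HM.
by rewrite -ler_pdivrMr.
Qed.

Lemma eventually_ex P : eventually P -> exists x, P x.
Proof. by move=> [M HM]; exists M; apply: HM. Qed.

Lemma eventually_forall_mem (I : eqType) (s : seq I) (P : I -> R -> Prop) :
  (forall i, i \in s -> eventually (P i)) ->
  eventually (fun x => forall i, i \in s -> P i x).
Proof.
elim: s => [|i s IHs] Ps; first by exists 0.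
have Pi := Ps i (mem_head i s).
have /IHs Ps' : forall j, j \in s -> eventually (P j).
  by move=> j js; apply: Ps; rewrite in_cons js orbT.
apply: eventually_mono (eventually_and Pi Ps') => x [Pix Psx] j.
by rewrite in_cons => /orP[/eqP->|/Psx].
Qed.

Lemma eventually_gt_linear u v c : 0 < u -> eventually (fun x => c < x * u + v).
Proof.
move=> u0; exists ((c - v + 1) / u) => x; rewrite ler_pdivrMr //; lra.
Qed.

(** One Horner step; starting from [eventually_gt_linear], it handles polynomials with positive
    leading coefficient. *)
Lemma eventually_gt_horner f z :
  (forall c, eventually (fun x => c < f x)) ->
  forall c, eventually (fun x => c < x * f x + z).
Proof.
move=> Hf c.
apply: eventually_mono (eventually_and (eventually_ge 1) (Hf `|c - z|)) => x [x1 fx].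
have := ler_norm (c - z); have := normr_ge0 (c - z); nra.
Qed.

End Eventually.

(** * Continuants of weighted paths and their sign changes *)

Section Continuant.
Variable R : realFieldType.
Implicit Types (a b e : nat -> R) (p : {poly R}) (t : seq R) (n : nat).

(** A new vertex brings a factor [x]; in the variable [x ^+ 2] it shows up only at every second
    vertex. *)
Definition weight n : {poly R} := if odd n then 'X else 1.

(* The path with edge weights [a 1, ..., a n.-1] has the characteristic polynomial
   ['X ^+ odd n * (cont a n \Po 'X^2)]; the weight [a 0] plays no role. *)
Fixpoint cont a n : {poly R} :=
  if n is m.+1 then
    weight m * cont a m - (a m)%:P * (if m is k.+1 then cont a k else 0)
  else 1.

Definition cont_pred a n : {poly R} := if n is m.+1 then cont a m else 0.

Definition ev_weight n (y : R) : R := if odd n then y else 1.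

Lemma contS a n (y : R) :
  (cont a n.+1).[y] =
  ev_weight n y * (cont a n).[y] - a n * (cont_pred a n).[y].
Proof.
by rewrite /= !hornerE /weight /ev_weight; case: odd; rewrite ?hornerX ?hornerC.
Qed.

(** The weight [a n.+1] multiplies only the old continuant, so a huge value decides the sign
    wherever that continuant is nonzero. *)
Lemma cont_add2 a n (y : R) :
  (cont a n.+2).[y] = (y - a n.+1) * (cont a n).[y]
    - ev_weight n.+1 y * a n * (cont_pred a n).[y].
Proof. rewrite !contS [cont_pred a n.+1]/= /ev_weight /=; case: (odd n) => /=; ring. Qed.

(** The two polynomials in [y] are the matching polynomials of the six-vertex path and of this path
    without its first vertex. *)
Lemma cont_add6 a n (y : R) :
  let a1 := a n.+1 in let a2 := a n.+2 in let a3 := a n.+3 in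
  let a4 := a n.+4 in let a5 := a n.+4.+1 in
  (cont a n.+4.+2).[y] =
    (y ^+ 3 - (a1 + a2 + a3 + a4 + a5) * y ^+ 2
      + (a1 * a3 + a1 * a4 + a1 * a5 + a2 * a4 + a2 * a5 + a3 * a5) * y
      - a1 * a3 * a5) * (cont a n).[y]
    - ev_weight n.+1 y * a n * (cont_pred a n).[y]
      * (y ^+ 2 - (a2 + a3 + a4 + a5) * y + (a2 * a4 + a2 * a5 + a3 * a5)).
Proof.
move=> a1 a2 a3 a4 a5; have predS m : cont_pred a m.+1 = cont a m by [].
rewrite !(cont_add2, contS, predS) /ev_weight /=.
rewrite -/a1 -/a2 -/a3 -/a4 -/a5; case: (odd n) => /=; ring.
Qed.

(** For [n > 0] both polynomials compared are monic of degree [n./2], so their ratio tends to 1; the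
    factor 2 is slack for the induction. *)
Lemma cont_asymptotics a n :
  eventually (fun y : R => 0 < (cont a n).[y] /\
    `|ev_weight n.+1 y * (cont_pred a n).[y]| <= 2 * (cont a n).[y]).
Proof.
elim: n => [|n IHn].
  by exists 0 => y _; rewrite /= !hornerE ?mulr0 normr0; split; lra.
apply: eventually_mono (eventually_and IHn (eventually_ge (4 * `|a n| + 1))).
move=> y [[u0 uv] ya]; rewrite contS [cont_pred a n.+1]/=.
move: ((cont a n).[y]) ((cont_pred a n).[y]) u0 uv => u v u0.
have a0 := normr_ge0 (a n).
rewrite /ev_weight /=; case: (odd n) => /=; rewrite !mul1r.
  rewrite ?mul1r => uv.
  have av : `|a n * v| <= `|a n| * (2 * u) by rewrite normrM ler_wpM2l.
  have := ler_norm (a n * v) => av'.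
  have ub : 2 * (y * u - a n * v) >= y * u by nra.
  split; first by nra.
  by rewrite ger0_norm //; nra.
have y0 : 0 < y by nra.
move=> uv.
have av : `|a n * (y * v)| <= `|a n| * (2 * u) by rewrite normrM ler_wpM2l.
have := ler_norm (a n * (y * v)) => av'.
have ub : y * u <= y * (2 * (u - a n * v)) by nra.
rewrite ler_pM2l // in ub.
split; first by lra.
by rewrite ger0_norm // ltW.
Qed.

Lemma cont_eq a b n : (forall i, (i < n)%N -> a i = b i) ->
  cont a n = cont b n /\ cont_pred a n = cont_pred b n.
Proof.
elim: n => // n IHn ab.
have [|/= cE pE] := IHn; first by move=> i /ltnW; apply: ab.
split=> //=; rewrite cE ab //.
by congr (_ - _ * _); exact: pE.
Qed.

(** Index [n] is the edge linking the old path to the new vertices; the old continuants see only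
    smaller indices. *)
Definition splice n a b := fun i => if (i < n)%N then a i else b i.

Lemma cont_splice n a b :
  cont (splice n a b) n = cont a n /\ cont_pred (splice n a b) n = cont_pred a n.
Proof. by apply: cont_eq => i ltin; rewrite /splice ltin. Qed.

Lemma splice_add n a b k : splice n a b (n + k) = b (n + k)%N.
Proof. by rewrite /splice ltnNge leq_addr. Qed.

(** [cont a n] is homogeneous of degree [n./2] in [y] and the weights together, so negating the
    weights reflects its roots through 0. *)
Lemma cont_opp a n (y : R) :
  (cont (fun i => - a i) n).[y] = (-1) ^+ n./2 * (cont a n).[- y].
Proof.
suff : (cont (fun i => - a i) n).[y] = (-1) ^+ n./2 * (cont a n).[- y] /\
  (cont (fun i => - a i) n.+1).[y] = (-1) ^+ uphalf n * (cont a n.+1).[- y].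
  by case.
elim: n => [|n [IH1 IH2]].
  by split; rewrite ?contS /= ?contS !hornerE /= ?mulr0 ?subr0 ?mulr1.
split=> //; rewrite contS IH2 [cont_pred _ _]/= IH1 (contS a n.+1) [cont_pred a n.+1]/=.
rewrite /ev_weight /= uphalf_half.
by case: (odd n); rewrite /= ?add0n ?add1n ?exprS; ring.
Qed.

Fixpoint alternating p (s : R) t :=
  if t is x :: t' then (0 < s * p.[x]) && alternating p (- s) t' else true.

Lemma alternating_neq0 p s t x : alternating p s t -> x \in t -> p.[x] != 0.
Proof.
elim: t s => //= y t IHt s /andP[sy /IHt{}IHt].
rewrite in_cons => /orP[/eqP->|//].
by apply: contraTneq sy => ->; rewrite mulr0 ltxx.
Qed.

Lemma alternating_transfer p q (k s : R) t :
  (forall x, x \in t -> 0 < k * (p.[x] * q.[x])) ->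
  alternating p s t -> alternating q (k * s) t.
Proof.
elim: t s => //= y t IHt s kpq /andP[sy alt]; apply/andP; split.
  have := mulr_gt0 sy (kpq y (mem_head _ _)).
  have -> : s * p.[y] * (k * (p.[y] * q.[y])) = (k * s * q.[y]) * p.[y] ^+ 2 by ring.
  have p0 : 0 < p.[y] ^+ 2.
    rewrite exprn_even_gt0 //=; apply: contraTneq sy => ->.
    by rewrite mulr0 ltxx.
  by rewrite pmulr_lgt0.
rewrite -mulrN; apply: IHt => // x xt.
by apply: kpq; rewrite in_cons xt orbT.
Qed.

(** [c] sign changes need [c + 1] points. They decrease from a point where [p] is positive, the sign
    of a continuant near infinity, so that larger points can be put in front. *)
Definition oscillates p (c : nat) := exists t : seq R,
  [/\ (c < size t)%N, sorted >%R t, all (> 0) t & alternating p 1 t].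

Definition realizes e a := forall i, 0 < e i * a i.

Definition can_oscillate e n c := exists2 a, realizes e a & oscillates (cont a n) c.

Lemma can_oscillate_0 e : (forall i, e i != 0) -> can_oscillate e 0 0.
Proof.
move=> e0; exists e; first by move=> i; rewrite -expr2 exprn_even_gt0 /=.
by exists [:: 1]; split=> //=; rewrite ?hornerE ?ltr01 // mulr1 ltr01.
Qed.

Lemma realizes_splice n e a b : realizes e a ->
  (forall i, (n <= i)%N -> 0 < e i * b i) -> realizes e (splice n a b).
Proof. by move=> ea eb i; rewrite /splice; case: ltnP => // /eb. Qed.

Lemma eventually_alternating p (q : R -> {poly R}) k t :
  (forall x, x \in t -> p.[x] != 0 -> eventually (fun T => 0 < k * (p.[x] * (q T).[x]))) ->
  alternating p 1 t -> eventually (fun T => alternating (q T) k t).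
Proof.
move=> pq alt.
have := eventually_forall_mem (fun x xt => pq x xt (alternating_neq0 alt xt)).
by apply: eventually_mono => T /alternating_transfer/(_ alt); rewrite mulr1.
Qed.

(** If the new edge is light enough, the continuant at each test point [x] is almost multiplied by
    [ev_weight n x], which is positive. *)
Lemma can_oscillateS e n c : (forall i, e i != 0) ->
  can_oscillate e n c -> can_oscillate e n.+1 c.
Proof.
move=> e0 [a ea [t [st sort_t pos_t alt]]].
pose b (T : R) i := e i / T.
pose a' T := splice n a (b T).
have ev : eventually (fun T => alternating (cont (a' T) n.+1) 1 t).
  apply: eventually_alternating alt => x xt px.
  have x0 : 0 < x by move/allP: pos_t => /(_ x xt).
  have w0 : 0 < ev_weight n x * (cont a n).[x] ^+ 2.
    by rewrite mulr_gt0 ?exprn_even_gt0 //= /ev_weight; case: odd.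
  have := eventually_and (eventually_ge 1)
    (eventually_gt_linear (- (e n * (cont_pred a n).[x] * (cont a n).[x])) 0 w0).
  apply: eventually_mono => T [T1 HT].
  have T0 : 0 < T by lra.
  rewrite contS /a' (cont_splice n a (b T)).1 (cont_splice n a (b T)).2.
  have := splice_add n a (b T) 0; rewrite addn0 => ->; rewrite /b.
  rewrite -(pmulr_rgt0 _ T0); apply: (@eq_ind R _ (> 0) HT).
  by field; lra.
have [T [altT T1]] := eventually_ex (eventually_and ev (eventually_ge 1)).
exists (a' T); last by exists t.
apply: realizes_splice => // i _; rewrite /b mulrA.
by rewrite divr_gt0 ?(lt_le_trans ltr01 T1) // -expr2 exprn_even_gt0 /=.
Qed.

(** A huge weight on edge [n.+1] multiplies the signs at the old points by that of [- e n.+1]. If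
    they flip, a point near infinity, where the continuant is positive, adds a sign change. *)
Lemma can_oscillate_add2 e n c : (forall i, e i != 0) ->
  can_oscillate e n c -> can_oscillate e n.+2 (c + (0 < e n.+1)%R)%N.
Proof.
move=> e0 [a ea [t [st sort_t pos_t alt]]].
have ee i : 0 < e i * e i by rewrite -expr2 exprn_even_gt0 //=.
pose b (T : R) i := if i == n.+1 then T * e i else e i.
pose a' T := splice n a (b T).
have contE T y : (cont (a' T) n.+2).[y] = (y - T * e n.+1) * (cont a n).[y]
    - ev_weight n.+1 y * e n * (cont_pred a n).[y].
  rewrite cont_add2 /a' (cont_splice n a (b T)).1 (cont_splice n a (b T)).2.
  have := splice_add n a (b T) 0; have := splice_add n a (b T) 1.
  rewrite addn1 addn0 => -> ->.
  by rewrite /b eqxx ltn_eqF.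
have ea' T : 1 <= T -> realizes e (a' T).
  move=> T1; apply: realizes_splice => // i _; rewrite /b; case: ifP => // _.
  by rewrite mulrCA mulr_gt0 // (lt_le_trans ltr01).
pose k : R := if 0 < e n.+1 then -1 else 1.
have ke : 0 < - (k * e n.+1).
  rewrite /k; case: (ltgtP 0 (e n.+1)) (e0 n.+1) => [en|en|<-] //= _; lra.
have ev : eventually (fun T => alternating (cont (a' T) n.+2) k t).
  apply: eventually_alternating alt => x xt px.
  have u0 : 0 < - (k * e n.+1) * (cont a n).[x] ^+ 2.
    by rewrite mulr_gt0 ?exprn_even_gt0 /=.
  have := eventually_gt_linear (k * (cont a n).[x] * (x * (cont a n).[x]
    - ev_weight n.+1 x * e n * (cont_pred a n).[x])) 0 u0.
  apply: eventually_mono => T HT; rewrite contE.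
  by apply: (@eq_ind R _ (> 0) HT); ring.
have [T [altT T1]] := eventually_ex (eventually_and ev (eventually_ge 1)).
exists (a' T); first exact: ea'.
move: altT; rewrite /k; case: ifP => en altT; last by exists t; rewrite addn0.
have := eventually_and (cont_asymptotics (a' T) n.+2)
  (eventually_and (eventually_ge 1) (eventually_ge (head 0 t + 1))).
case/eventually_ex => z [[cz _] [z1 zt]].
exists (z :: t); split=> //=; first by rewrite addn1 ltnS.
- case: t {st pos_t alt ev altT} sort_t zt => //= h t -> zt.
  rewrite andbT; lra.
- by rewrite pos_t andbT (lt_le_trans ltr01).
- by rewrite mul1r cz altT.
Qed.

(* With weights [T * (-1/10, 1, 1, 1, -1/10)] on the five edges, the polynomial of the
   new block is [T ^+ 3 * g (y / T)] with [g z = z^3 - 2.8 z^2 + 0.61 z - 0.01], which has the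
   signs [-, +, -, +] at [0, 1/10, 1, 3]. *)
Lemma can_oscillate_block e n c : (forall i, e i != 0) ->
  e n.+1 < 0 -> 0 < e n.+2 -> 0 < e n.+3 -> 0 < e n.+4 -> e n.+4.+1 < 0 ->
  can_oscillate e n c -> can_oscillate e n.+4.+2 (c + 3).
Proof.
move=> e0 e1 e2 e3 e4 e5 [a ea [t [st sort_t pos_t alt]]].
have ee i : 0 < e i * e i by rewrite -expr2 exprn_even_gt0 //=.
(* Entry 0 is the linking edge, entries 1 to 5 the edges inside the block; later edges take the
   default [e i]. *)
pose b (T : R) i :=
  nth (e i) [:: e n; - (T / 10); T; T; T; - (T / 10)] (i - n).
pose a' T := splice n a (b T).
have a'E T k : a' T (n + k)%N =
    nth (e (n + k)%N) [:: e n; - (T / 10); T; T; T; - (T / 10)] k.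
  by rewrite /a' splice_add /b addKn.
have contE T y : (cont (a' T) n.+4.+2).[y] =
    (y ^+ 3 - 28 / 10 * T * y ^+ 2 + 61 / 100 * T ^+ 2 * y - T ^+ 3 / 100)
      * (cont a n).[y]
    - ev_weight n.+1 y * (cont_pred a n).[y] * e n
      * (y ^+ 2 - 29 / 10 * T * y + 8 / 10 * T ^+ 2).
  rewrite cont_add6 (cont_splice n a (b T)).1 (cont_splice n a (b T)).2 -/(a' T).
  have := a'E T 0; have := a'E T 1; have := a'E T 2; have := a'E T 3.
  have := a'E T 4; have := a'E T 5; rewrite !addnS addn0 /= => -> -> -> -> -> ->.
  by field; rewrite ?pnatr_eq0.
have ea' T : 1 <= T -> realizes e (a' T).
  move=> T1; apply: realizes_splice => // i leni; rewrite /b.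
  rewrite -(subnKC leni) addKn; move: (i - n)%N => k.
  case: k => [|[|[|[|[|[|k]]]]]] /=; rewrite ?nth_nil ?addnS ?addn0 ?ee //.
  - by rewrite nmulr_rgt0 //; lra.
  - by rewrite pmulr_rgt0 //; lra.
  - by rewrite pmulr_rgt0 //; lra.
  - by rewrite pmulr_rgt0 //; lra.
  - by rewrite nmulr_rgt0 //; lra.
(* At a fixed point the term [- T ^+ 3 / 100] dominates, so all old signs flip. *)
have old : eventually (fun T => alternating (cont (a' T) n.+4.+2) (-1) t).
  apply: eventually_alternating alt => x xt px.
  have u0 : 0 < (cont a n).[x] ^+ 2 / 100 by rewrite divr_gt0 ?exprn_even_gt0.
  move: ((cont a n).[x]) ((cont_pred a n).[x]) (ev_weight n.+1 x) u0 (contE^~ x)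
    => u v w u0 qE.
  (* [B], [C], [D] are the coefficients of [T ^+ 2], [T] and 1 in minus the product of the old and
     new continuants at [x]; that of [T ^+ 3] is [u ^+ 2 / 100]. *)
  pose B := - (61 / 100 * x * u ^+ 2) + 8 / 10 * (w * v * e n) * u.
  pose C := 28 / 10 * x ^+ 2 * u ^+ 2 - 29 / 10 * x * (w * v * e n) * u.
  pose D := - (x ^+ 3 * u ^+ 2) + w * v * e n * x ^+ 2 * u.
  have := fun c => eventually_gt_linear B c u0.
  move=> /(eventually_gt_horner C)/(eventually_gt_horner D)/(_ 0).
  apply: eventually_mono => T HT; rewrite qE.
  by apply: (@eq_ind R _ (> 0) HT); rewrite /B /C /D; field; rewrite ?pnatr_eq0.
pose g (z : R) := z ^+ 3 - 28 / 10 * z ^+ 2 + 61 / 100 * z - 1 / 100.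
pose h (z : R) := z ^+ 2 - 29 / 10 * z + 8 / 10.
(* At [T * z] the main term is [T ^+ 3 * g z] times the old continuant, while [cont_asymptotics]
   bounds the other one by order [T ^+ 2] times it. *)
have new k z : 0 < z -> 0 < k * g z ->
    eventually (fun T => 0 < k * (cont (a' T) n.+4.+2).[T * z]).
  move=> z0 gz.
  have := eventually_and (eventually_ge 1) (eventually_and
    (eventually_gt_linear (- (2 * `|k * e n * h z|)) 0 gz)
    (eventually_scale z0 (cont_asymptotics a n))).
  apply: eventually_mono => T [T1 [HT [u0 uv]]]; rewrite contE.
  move: ((cont a n).[T * z]) (ev_weight n.+1 (T * z) * (cont_pred a n).[T * z])
    u0 uv => u v u0 uv.
  have kehv : k * e n * h z * v <= `|k * e n * h z| * (2 * u).
    by apply: le_trans (ler_norm _) _; rewrite normrM ler_wpM2l.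
  have T0 : 0 < T ^+ 2 by rewrite exprn_gt0 // (lt_le_trans ltr01).
  have : 0 < T ^+ 2 * (T * (k * g z) * u - k * e n * h z * v).
    rewrite mulr_gt0 // subr_gt0; apply: le_lt_trans kehv _.
    rewrite [ltLHS]mulrA ltr_pM2r //; lra.
  move=> HT'; apply: (@eq_ind R _ (> 0) HT').
  by rewrite /g /h; field; rewrite ?pnatr_eq0.
have new1 := new 1 (1 / 10) ltac:(lra) ltac:(rewrite /g; lra).
have new2 := new (-1) 1 ltac:(lra) ltac:(rewrite /g; lra).
have new3 := new 1 3 ltac:(lra) ltac:(rewrite /g; lra).
have [T [altT [T1 [Tt [z1 [z2 z3]]]]]] := eventually_ex (eventually_and old
  (eventually_and (eventually_ge 1) (eventually_and (eventually_ge (10 * head 0 t + 1))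
  (eventually_and new1 (eventually_and new2 new3))))).
exists (a' T); first exact: ea'.
(* The signs are [+], [-], [+] at the new points, then [-] at the head of [t]: three more
   changes. *)
exists [:: T * 3, T * 1, T * (1 / 10) & t]; split.
- by rewrite addn3 /= !ltnS.
- rewrite /= ; apply/and3P; split; [lra|lra|].
  by case: t Tt sort_t {st pos_t alt old altT} => //= x t Tt ->; rewrite andbT; lra.
- by rewrite /= pos_t; apply/and4P; split=> //; lra.
- by rewrite /= opprK z1 z2 z3.
Qed.

End Continuant.

(** * Sign changes for a sign sequence and its negative, counted together *)

Section Antipodal.
Variable R : realFieldType.
Implicit Types (a e : nat -> R) (n k : nat).

(* Negating the weights exchanges positive and negative roots, i.e. real and purely
   imaginary eigenvalues. *)
Definition antipodal e n k := exists c d,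
  [/\ can_oscillate e n c, can_oscillate (fun i => - e i) n d & (k <= c + d)%N].

Lemma antipodal_opp e n k : antipodal e n k -> antipodal (fun i => - e i) n k.
Proof.
move=> [c [d [[a ea osc_c] osc_d le_k]]]; exists d, c; split=> //; last by rewrite addnC.
by exists a => // i; rewrite opprK.
Qed.

Variable e : nat -> R.
Hypothesis e_neq0 : forall i, e i != 0.

Let Ne_neq0 i : - e i != 0. Proof. by rewrite oppr_eq0. Qed.

(** The edge inside a new pair is positive for exactly one of [e] and [- e], which gains 1. If [r]
    is odd, a single vertex is added first, without loss. *)
Lemma antipodal_extend n k r : antipodal e n k -> antipodal e (n + r) (k + r./2).
Proof.
have step2 m j : antipodal e m j -> antipodal e m.+2 j.+1.
  move=> [c [d [/can_oscillate_add2 oc /can_oscillate_add2 od le_j]]].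
  exists (c + (0 < e m.+1)%R)%N, (d + (0 < - e m.+1)%R)%N; split=> //.
    exact: oc.
    exact: od.
  by rewrite oppr_gt0; case: (ltgtP 0 (e m.+1)) (e_neq0 m.+1) => //=; lia.
have step1 m j : antipodal e m j -> antipodal e m.+1 j.
  by move=> [c [d [/can_oscillateS oc /can_oscillateS od le_j]]]; exists c, d; split; auto.
move=> nk; rewrite -{1}[r]odd_double_half; elim: r./2 => [|m IHm].
  by rewrite double0 !addn0; case: odd; rewrite ?addn1 ?addn0; auto.
by rewrite doubleS !addnS; apply: step2.
Qed.

Lemma antipodal_half n : antipodal e n n./2.
Proof.
apply: (@antipodal_extend 0 0); exists 0%N, 0%N.
by split=> //; apply: can_oscillate_0.
Qed.

(* Matching the six vertices in consecutive pairs gives 2 for [e] but only 1 for [- e];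
   the dense choice of weights in [can_oscillate_block] raises the latter to 3. *)
Lemma antipodal_block n k :
  0 < e n.+1 -> e n.+2 < 0 -> e n.+3 < 0 -> e n.+4 < 0 -> 0 < e n.+4.+1 ->
  antipodal e n k -> antipodal e n.+4.+2 (k + 5).
Proof.
move=> e1 e2 e3 e4 e5 [c [d [oc od le_k]]].
have oc' := can_oscillate_add2 e_neq0 (can_oscillate_add2 e_neq0
  (can_oscillate_add2 e_neq0 oc)).
exists (c + 2)%N, (d + 3)%N; split; last by lia.
  by move: oc'; rewrite e1 e5 ltNge (ltW e3) addn0 -addnA.
by apply: can_oscillate_block od; rewrite ?oppr_lt0 ?oppr_gt0.
Qed.

End Antipodal.

(** * From sign changes to real eigenvalues *)

Section CharPoly.
Variable R : rcfType.
Implicit Types (p : {poly R}) (t z : seq R) (n : nat).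

(** The intermediate value theorem gives a root in each gap between consecutive points. *)
Lemma alternating_roots p (s x : R) t :
  path >%R x t -> all (> 0) (x :: t) -> alternating p s (x :: t) ->
  exists z, [/\ size z = size t, path >%R x z, all (> 0) z & all (root p) z].
Proof.
elim: t s x => [|y t IHt] s x; first by exists [::].
move=> /andP[/= xy yt] /and3P[x0 y0 t0] /andP[sx alt].
have [|z [sz yz z0 rz]] := IHt _ _ yt _ alt; first by rewrite /= y0.
have [|r] := @poly_ivtoo _ p y x (ltW xy).
  have /andP[sy _] := alt.
  have := mulr_gt0 sx sy; have s2 := sqr_ge0 s; nra.
rewrite in_itv /= => /andP[yr rx] rr; exists (r :: z); split=> /=.
- by rewrite sz.
- rewrite rx /=; case: z yz {sz z0 rz} => //= h z /andP[hy ->].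
  by rewrite (lt_trans hy yr).
- by rewrite (lt_trans y0 yr).
- by rewrite rr.
Qed.

Lemma oscillates_roots p c : oscillates p c ->
  exists z, [/\ (c <= size z)%N, uniq z, all (> 0) z & all (root p) z].
Proof.
move=> [[|x t] [] // st xt t0 alt].
have [z [sz xz z0 rz]] := alternating_roots xt t0 alt.
exists z; split=> //; first by rewrite sz.
apply: (@sorted_uniq _ >%R); [|exact: ltxx|exact: path_sorted xz].
by move=> u v w uv vw; apply: lt_trans uv.
Qed.

Lemma char_poly_tridiagonal (F : nat -> nat -> R) a n :
  (forall i j, (i.+1 < j)%N || (j.+1 < i)%N -> F i j = 0) ->
  (forall i, F i i = 0) ->
  (forall i, (i.+1 < n)%N -> F i i.+1 * F i.+1 i = a i.+1) ->
  char_poly (\matrix_(i < n, j < n) F i j) = 'X ^+ odd n * (cont a n \Po 'X^2).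
Proof.
move=> Ftri Fdiag Fa.
pose G i j := 'X *+ (i == j :> nat) - (F i j)%:P.
have charE m : char_poly (\matrix_(i < m, j < m) F i j) =
    \det (\matrix_(i < m, j < m) G i j).
  by rewrite /char_poly; congr (\det _); apply/matrixP => i j; rewrite !mxE.
have Gtri i j : (i.+1 < j)%N || (j.+1 < i)%N -> G i j = 0.
  move=> ij; rewrite /G Ftri // subr0.
  by rewrite (_ : (i == j) = false) //; apply/eqP => ij'; move: ij; rewrite ij'; lia.
rewrite charE.
(* The recursion needs two consecutive sizes; the guard makes the second claim vacuous for
   [n = 0]. *)
suff [] : \det (\matrix_(i < n, j < n) G i j) = 'X ^+ odd n * (cont a n \Po 'X^2) /\
  (n.-1.+1 = n -> \det (\matrix_(i < n.-1, j < n.-1) G i j)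
     = 'X ^+ odd n.-1 * (cont a n.-1 \Po 'X^2)) by [].
elim: n Fa {charE} => [|n IHn] Fa.
  by rewrite det_mx00 expr0 mul1r comp_polyC.
have [|IH1 IH2] := IHn; first by move=> i /ltnW; apply: Fa.
split=> //; case: n Fa IH1 IH2 {IHn} => [|n] Fa IH1 IH2.
  rewrite det_mx11 mxE /G eqxx Fdiag subr0 /= mul1r mulr0 subr0.
  by rewrite comp_polyC mulr1 expr1.
rewrite det_tridiagonal_rec // IH1 IH2 // /G eqxx Fdiag subr0.
rewrite !eqn_leq ltnn andbF leqnSn mulr0n mulr1n !sub0r mulrNN -polyCM Fa //.
have compE (w u v : {poly R}) c : (w * u - c%:P * v) \Po 'X^2 =
    (w \Po 'X^2) * (u \Po 'X^2) - c%:P * (v \Po 'X^2).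
  by rewrite comp_polyB !comp_polyM comp_polyC.
rewrite [cont a n.+2 \Po _](compE (weight R n.+1) (cont a n.+1) (cont a n)) /weight.
have [-> ->] : odd n.+2 = odd n /\ odd n.+1 = ~~ odd n by rewrite /= negbK.
move: (cont a n.+1 \Po 'X^2) (cont a n \Po 'X^2) => u v.
have C1 : (1 : {poly R}) \Po 'X^2 = 1 by rewrite -polyC1 comp_polyC.
by case: (odd n); rewrite /= ?comp_polyX ?C1; ring.
Qed.

End CharPoly.

Section NbRealEigenvalues.
Variable R : realType.
Implicit Types (a : nat -> R) (n c : nat).

(** Each positive root of the continuant gives two eigenvalues, its two square roots. *)
Lemma oscillates_nb_real_ge n (A : 'M[R]_n) a c :
  char_poly A = 'X ^+ odd n * (cont a n \Po 'X^2) -> oscillates (cont a n) c ->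
  (c.*2 <= nb_real_eigenvalues A)%N.
Proof.
move=> Ap /oscillates_roots[z [cz uz z0 rz]].
have sqrtz x : x \in z -> 0 < Num.sqrt x by move/(allP z0); rewrite sqrtr_gt0.
pose s := map Num.sqrt z ++ map (fun x => - Num.sqrt x) z.
have ss : size s = (size z).*2 by rewrite size_cat !size_map addnn.
apply: (@leq_trans (size s)); first by rewrite ss leq_double.
apply: size_roots_le_sum_mup; first exact/monic_neq0/char_poly_monic.
- rewrite cat_uniq !map_inj_in_uniq ?uz /= ?andbT.
  + apply/hasPn => _ /mapP[x xz ->]; apply/mapP => -[y yz E].
    by have := sqrtz _ xz; have := sqrtz _ yz; rewrite -E oppr_gt0 => /ltW; rewrite leNgt => /negP.
  + move=> x y xz yz /oppr_inj E.
    by rewrite -[x]sqr_sqrtr ?E ?sqr_sqrtr //; apply/ltW/(allP z0).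
  + move=> x y xz yz E.
    by rewrite -[x]sqr_sqrtr ?E ?sqr_sqrtr //; apply/ltW/(allP z0).
have rootA x : x \in z -> forall y, y ^+ 2 = x -> root (char_poly A) y.
  move=> xz y yx; rewrite Ap rootM; apply/orP; right.
  by rewrite /root horner_comp hornerXn yx; apply: (allP rz).
rewrite all_cat !all_map; apply/andP; split; apply/allP => x xz /=;
  apply: (rootA x) => //; rewrite ?sqrrN sqr_sqrtr //; exact/ltW/(allP z0).
Qed.

(** Each positive root [y] of [cont a n] is a root [- y] for the negated weights, hence a factor
    ['X^2 + y] without real roots: two degrees are lost. *)
Lemma oscillates_nb_real_le n (A : 'M[R]_n) a c :
  char_poly A = 'X ^+ odd n * (cont (fun i => - a i) n \Po 'X^2) ->
  oscillates (cont a n) c ->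
  (c.*2 + nb_real_eigenvalues A <= n)%N.
Proof.
move=> Ap /oscillates_roots[z [cz uz /allP z0 rz]].
pose s := map -%R z.
have rs : all (root (cont (fun i => - a i) n)) s.
  rewrite all_map; apply/allP => x /(allP rz)/= /eqP rx.
  by rewrite /root cont_opp opprK rx mulr0.
have us : poly.uniq_roots s by rewrite uniq_rootsE map_inj_uniq //; apply: oppr_inj.
have [g Dg] := uniq_roots_prod_XsubC rs us.
pose h := (\prod_(y <- s) ('X - y%:P)) \Po 'X^2.
pose q := 'X ^+ odd n * (g \Po 'X^2).
have {}Ap : char_poly A = h * q.
  by rewrite Ap Dg comp_polyM /h /q; ring.
have hq0 : h * q != 0 by rewrite -Ap; apply/monic_neq0/char_poly_monic.
have h_rootless x : ~~ root h x.
  rewrite /root horner_comp horner_prod prodf_seq_neq0; apply/allP => _ /mapP[y yz ->].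
  rewrite /= !hornerE; have := z0 _ yz; have := sqr_ge0 x; lra.
have := hq0; rewrite mulf_eq0 negb_or => /andP[h0 q0].
have sh : (size h).-1 = (size z * 2)%N.
  by rewrite size_comp_poly size_prod_XsubC size_polyXn size_map.
have := sum_mup_rootless hq0 h_rootless; rewrite -Ap.
have := size_char_poly A; rewrite {1}Ap size_mul //.
move: (size h) (size q) (size_poly_gt0 h) (size_poly_gt0 q) sh; rewrite h0 q0.
rewrite -/(nb_real_eigenvalues A); move: (nb_real_eigenvalues A) => k; lia.
Qed.

End NbRealEigenvalues.

(** * Sign patterns *)

Section Pattern.
Variables (n : nat) (P : 'M[int]_n).
Hypotheses (Ptri : is_tridiagonal P) (Pdiag : has_zero_diagonal P).

Lemma tridiagonal_neighbours i j : P i j != 0 -> i.+1 = j \/ j.+1 = i :> nat.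
Proof.
move=> Pij; have /negP := contra_neq_not (@Ptri i j) Pij.
have : i != j :> nat.
  by apply: contraNneq Pij => /val_inj ->; rewrite Pdiag.
by lia.
Qed.

(* Increasing row and column selections cannot skip vertices: the nonzero entries of the
   submatrix just above and below the diagonal force both selections to be the same interval. *)
Lemma submatrix_interval (B : 'M[int]_6) :
  (forall i j : 'I_6, i.+1 = j :> nat -> B i j != 0 /\ B j i != 0) ->
  is_submatrix B P -> exists f : 'I_6 -> 'I_n, exists l : nat,
    (forall i, f i = (l + i)%N :> nat) /\ mxsub f f P = B.
Proof.
move=> Bnz [f [g [fmono gmono BE]]].
have adj (i j : 'I_6) : i.+1 = j :> nat ->
    (f i).+1 = g j \/ (g j).+1 = f i :> nat.
  move=> /Bnz[Bij _]; apply: tridiagonal_neighbours.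
  by move: Bij; rewrite -BE mxE.
have adj' (i j : 'I_6) : i.+1 = j :> nat ->
    (f j).+1 = g i \/ (g i).+1 = f j :> nat.
  move=> /Bnz[_ Bji]; apply: tridiagonal_neighbours.
  by move: Bji; rewrite -BE mxE.
have fg (i : 'I_6) : f i = (f ord0 + i)%N :> nat /\ g i = f i :> nat.
  have [F [G [FE GE]]] : exists F G : nat -> nat,
      (forall i : 'I_6, f i = F i :> nat) /\ (forall i : 'I_6, g i = G i :> nat).
    exists (fun k => f (inord k)), (fun k => g (inord k)).
    by split=> j; rewrite inord_val.
  have o k : (k < 6)%N -> exists i : 'I_6, i = k :> nat.
    by move=> k6; exists (Ordinal k6).
  have a k : (k < 5)%N -> [/\ (F k < F k.+1)%N, (G k < G k.+1)%N,
      (F k).+1 = G k.+1 \/ (G k.+1).+1 = F k & (F k.+1).+1 = G k \/ (G k).+1 = F k.+1].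
    move=> k5; have [i0 ik] := o k (ltnW k5); have [i1 ik1] := o k.+1 k5.
    have i01 : i0.+1 = i1 :> nat by rewrite ik ik1.
    rewrite -ik1 -ik -!FE -!GE; split; [apply: fmono|apply: gmono|exact: adj|exact: adj'];
      by rewrite -i01.
  rewrite GE !FE /=; have := ltn_ord i; move: (i : nat) => k k6.
  have := a 0%N isT; have := a 1%N isT; have := a 2%N isT; have := a 3%N isT; have := a 4%N isT.
  by case: k k6 => [|[|[|[|[|[|//]]]]]] _; do !case=> ? ? ? ?; lia.
exists f, (f ord0 : nat); split=> [i|]; first by case: (fg i).
rewrite -BE; apply/matrixP => i j; rewrite !mxE; congr (P _ _).
by apply: val_inj => /=; case: (fg j) => _ ->.
Qed.

End Pattern.

(** * Matrices of the class with prescribed edge weights *)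

Section Realization.
Variables (R : realType) (n : nat) (P : 'M[int]_n.+1).
Hypotheses (Psign : is_sign_pattern P) (Pirr : is_irreducible_tridiagonal P).
Hypothesis (Pdiag : has_zero_diagonal P).

(* The sign of the edge joining the vertices [i.-1] and [i]. *)
Definition path_sign (i : nat) : int :=
  if (0 < i <= n)%N then edge_sign P (inord i.-1) (inord i) else 1.

Lemma path_sign_unit i : path_sign i = 1 \/ path_sign i = -1.
Proof.
rewrite /path_sign /edge_sign; case: ifP => [/andP[i0 ltin]|_]; last by left.
have [|P1 P2] := Pirr.2 (inord i.-1) (inord i).
  by rewrite !inordK ?prednK // leqW.
have := Psign (inord i.-1) (inord i); have := Psign (inord i) (inord i.-1).
rewrite !inE (negbTE P1) (negbTE P2) !orbF.
by case/orP => /eqP-> /orP[]/eqP->; [left|right|right|left].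
Qed.

Lemma path_matrix (a : nat -> R) : realizes (fun i => (path_sign i)%:~R) a ->
  exists A : 'M[R]_n.+1, in_qualitative_class P A /\
    char_poly A = 'X ^+ odd n.+1 * (cont a n.+1 \Po 'X^2).
Proof.
move=> Pa.
(* Only products of opposite entries matter, so the superdiagonal carries the absolute values and
   the subdiagonal only signs. *)
pose F i j : R := if (i.+1 < j)%N || (j.+1 < i)%N then 0 else
  (P (inord i) (inord j))%:~R * (if j == i.+1 then `|a j| else 1).
exists (\matrix_(i < n.+1, j < n.+1) F i j); split.
  move=> i j; rewrite mxE /F; case: ifP => [/(Pirr.1)->|_]; first by rewrite sgz0.
  rewrite !inord_val sgzM [X in _ * X]gtr0_sgz ?mulr1.
    rewrite sgz_int; have := Psign i j.
    by rewrite !inE => /or3P[]/eqP->.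
  case: eqP => // ji; rewrite normr_gt0; have := Pa j.
  by apply: contraTneq => ->; rewrite mulr0 ltxx.
apply: char_poly_tridiagonal => [i j ij|i|i lein].
- by rewrite /F ij.
- by rewrite /F Pdiag mul0r; case: ifP.
have far : (i.+2 < i)%N = false by lia.
rewrite /F !ltnn far eqxx ltn_eqF // mulr1 /=.
have -> : `|a i.+1| = (path_sign i.+1)%:~R * a i.+1.
  rewrite -(ger0_norm (ltW (Pa i.+1))) normrM.
  by case: (path_sign_unit i.+1) => ->; rewrite ?rmorphN ?normrN normr1 mul1r.
have -> : (P (inord i) (inord i.+1))%:~R * ((path_sign i.+1)%:~R * a i.+1)
    * (P (inord i.+1) (inord i))%:~R
   = (path_sign i.+1 * path_sign i.+1)%:~R * a i.+1.
  by rewrite /path_sign /= -ltnS lein /edge_sign !rmorphM /=; ring.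
by case: (path_sign_unit i.+1) => ->; rewrite ?mulrNN mulr1 mulr1z mul1r.
Qed.

(** A constant number [r] of real eigenvalues would satisfy [2c <= r] and [2d + r <= n.+1], hence
    [2(c + d) <= n.+1]. *)
Lemma antipodal_not_consistent k :
  antipodal (fun i => (path_sign i)%:~R : R) n.+1 k -> (n.+1 < k.*2)%N ->
  ~ is_consistent R P.
Proof.
move=> [c [d [[a Pa osc_a] [b Pb osc_b] le_k]]] ltnk [r Pr].
have [A [PA Ap]] := path_matrix Pa.
have [|B [PB Bp]] := @path_matrix (fun i => - b i).
  by move=> i; have := Pb i; rewrite mulNr mulrN.
have := oscillates_nb_real_ge Ap osc_a; have := oscillates_nb_real_le Bp osc_b.
rewrite !Pr //; move: ltnk le_k; rewrite -!mul2n; lia.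
Qed.

End Realization.

(** Merges the two cases of the theorem: edge reversal is the global sign [s = -1]. *)
Lemma P6_edge_signs (B : 'M[int]_6) : B = P6 \/ is_edge_reversal P6 B ->
  (forall i j : 'I_6, i.+1 = j :> nat -> B i j != 0 /\ B j i != 0) /\
  exists2 s : int, s = 1 \/ s = -1 & forall i j : 'I_6, i.+1 = j :> nat ->
    edge_sign B i j = s * nth 0 [:: 1; -1; -1; -1; 1] i.
Proof.
have P6nz (i j : 'I_6) : i.+1 = j :> nat -> P6 i j != 0 /\ P6 j i != 0.
  case: i j => [i i6] [j j6] /= ij; rewrite !mxE /=; move: j6; rewrite -ij.
  by case: i {i6 ij} => [|[|[|[|[|//]]]]].
have P6s (i j : 'I_6) : i.+1 = j :> nat ->
    edge_sign P6 i j = nth 0 [:: 1; -1; -1; -1; 1] i.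
  case: i j => [i i6] [j j6] /= ij; rewrite /edge_sign !mxE /=; move: j6; rewrite -ij.
  by case: i {i6 ij} => [|[|[|[|[|//]]]]].
move=> [->|[_ B0 Bs]].
  by split=> //; exists 1 => [|i j ij]; [left|rewrite P6s // mul1r].
split=> [i j /P6nz|]; first by rewrite !B0.
exists (-1) => [|i j ij]; first by right.
rewrite Bs ?P6s ?mulN1r // /is_edge (P6nz _ _ ij).1 andbT.
by apply/eqP => /(congr1 (@nat_of_ord 6)); rewrite -ij => /eqP; rewrite ltn_eqF.
Qed.

Theorem theorem3p13 (R : realType) (n : nat) (P : 'M[int]_n)
    (Psign : is_sign_pattern P)
    (Pirr : is_irreducible_tridiagonal P)
    (Pdiag : has_zero_diagonal P)
    (Psub : is_submatrix P6 P \/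
            exists M : 'M[int]_6, is_edge_reversal P6 M /\ is_submatrix M P) :
  ~ is_consistent R P.
Proof.
have [B Bcase BP] : exists2 B : 'M[int]_6,
    B = P6 \/ is_edge_reversal P6 B & is_submatrix B P.
  by case: Psub => [?|[M [? ?]]]; [exists P6 => //; left|exists M => //; right].
have [Bnz [s s1 Bs]] := P6_edge_signs Bcase.
have [f [l [fl fB]]] := submatrix_interval Pirr.1 Pdiag Bnz BP.
have len : (l + 5 < n)%N by have := ltn_ord (f ord_max); rewrite fl.
case: n P Psign Pirr Pdiag {Psub BP} f fl fB len => [|n] P Psign Pirr Pdiag f fl fB len.
  by move: len; rewrite ltn0.
pose e i : R := (path_sign P i)%:~R.
have e0 i : e i != 0.
  by rewrite /e; case: (path_sign_unit Psign Pirr i) => ->; rewrite ?rmorphN ?oppr_eq0 oner_eq0.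
have eE k : (k < 5)%N -> e (k.+1 + l)%N = (s * nth 0 [:: 1; -1; -1; -1; 1] k)%:~R.
  move=> k5; have k6 : (k < 6)%N := ltnW k5.
  have <- := Bs (Ordinal k6) (Ordinal (k5 : k.+1 < 6)%N) erefl.
  rewrite addSn addnC /e /path_sign (_ : (0 < _ <= n)%N = true); last by lia.
  rewrite -fB /edge_sign !mxE /=.
  have -> : inord (l + k) = f (Ordinal k6).
    by apply: val_inj; rewrite /= fl inordK //; lia.
  have -> // : inord (l + k).+1 = f (Ordinal (k5 : k.+1 < 6)%N).
  by apply: val_inj; rewrite /= fl inordK /= ?addnS //; lia.
have [r nE] : exists r, n.+1 = (l.+4.+2 + r)%N.
  by exists (n.+1 - l.+4.+2)%N; lia.
have anti : antipodal e l.+4.+2 (l./2 + 5).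
  have := eE 0%N isT; have := eE 1%N isT; have := eE 2%N isT; have := eE 3%N isT.
  have := eE 4%N isT; rewrite /= => e5 e4 e3 e2 e1.
  have half := antipodal_half e0 l.
  case: s1 e5 e4 e3 e2 e1 => -> e5 e4 e3 e2 e1.
    by apply: (antipodal_block e0 _ _ _ _ _ half);
      rewrite ?e1 ?e2 ?e3 ?e4 ?e5 ?ltr0z ?ltrz0.
  (* For [s = -1] the block lemma applies to [- e]; exchanging the two counts returns to [e]. *)
  have Ne0 i : - e i != 0 by rewrite oppr_eq0.
  have Nhalf := antipodal_opp half.
  have := antipodal_block Ne0 _ _ _ _ _ Nhalf; rewrite e1 e2 e3 e4 e5.
  rewrite !oppr_gt0 !oppr_lt0 ltr01.
  case/(_ isT isT isT isT isT)/antipodal_opp => c [d [[a ea oc] [b eb od] le_c]].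
  exists c, d; split=> //; [exists a => // i|exists b => // i].
    by have := ea i; rewrite opprK.
  by have := eb i; rewrite opprK.
have := antipodal_extend e0 r anti; rewrite -nE => /antipodal_not_consistent.
apply=> //.
(* Rounding [l] and [r] down to even numbers loses at most 2, and twice the block's 5 exceeds its 6
   vertices by 4. *)
have := odd_double_half l; have := odd_double_half r; lia.
Qed.
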